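(* Let $r\ge 1$ and let $G,H$ be graphs with $G\xrightarrow{r} H$. Then for every positive integer $t$, $G[c^t]$ is canonically $r$-Ramsey for $H[t]$, where $$c=\exp\left(\frac{r^{v(H)}\,4^{v(H)^2-v(H)}}{\lambda_r(H,G)^{v(H)}}\right).$$
   Context: All graphs are finite and simple; $v(H)$ is the number of vertices of $H$. $G\xrightarrow{r}H$ means every $r$-colouring of the edges of $G$ contains a monochromatic copy of $H$. The $r$-multiplicity $M_r(H,G)$ is the minimum, over all $r$-colourings of the edges of $G$, of the number of monochromatic copies (subgraphs isomorphic to $H$) of $H$; so $M_1(H,G)$ is the number of copies of $H$ in $G$. The Ramsey $r$-robustness is $\lambda_r(H,G)=M_r(H,G)/M_1(H,G)$. For a graph $G$ with vertices $v_1,\dots,v_m$, the $n$-blowup $G[n]$ replaces each $v_i$ by an independent set $U_i$ of $n$ vertices and puts a complete bipartite graph between $U_i$ and $U_j$ for each edge $v_iv_j$. A copy of $H[t]$ in $G[n]$ is canonical if there is a copy $H'$ of $H$ in $G$ and sets $S_i\subseteq U_i$, $|S_i|=t$, for each vertex $v_i$ of $H'$, with the copy consisting of $\bigcup S_i$ and all edges between $S_i,S_j$ for edges $v_iv_j$ of $H'$. $G[n]$ is canonically $r$-Ramsey for $H[t]$ if every $r$-colouring of the edges of $G[n]$ has a monochromatic canonical copy of $H[t]$. For non-integer $x$, $G[x]$ means $G[\lceil x\rceil]$. *)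

(* Defs.v *)
From HB Require Import structures.
From mathcomp Require Import all_boot all_order all_algebra.
From mathcomp Require Import all_classical all_reals all_analysis.

Set Implicit Arguments.
Unset Strict Implicit.
Unset Printing Implicit Defensive.

Import Order.TTheory GRing.Theory Num.Theory.

Record sgraph := SGraph {
  svertex :> finType;
  sedge : rel svertex;
  sedge_sym : symmetric sedge;
  sedge_irr : irreflexive sedge
}.

Definition edges (G : sgraph) : {set {set G}} :=
  [set [set p.1; p.2] | p : G * G & sedge p.1 p.2].

Definition edge (G : sgraph) := {e : {set G} | e \in edges G}.

Definition coloring (r : nat) (G : sgraph) := {ffun edge G -> 'I_r}.

(* A subgraph is a pair (vertex set, edge set) satisfying [is_subgraph]. *)
Definition subgr (G : sgraph) := ({set G} * {set {set G}})%type.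

Definition is_subgraph (G : sgraph) (P : subgr G) : bool :=
  (P.2 \subset edges G) && [forall e in P.2, e \subset P.1].

Definition iso_to (H G : sgraph) (P : subgr G) : bool :=
  [exists f : {ffun H -> G},
    [&& injectiveb f,
        f @: [set: H] == P.1 &
        [set f @: (e : {set H}) | e in edges H] == P.2]].

Definition copies (H G : sgraph) : {set subgr G} :=
  [set P : subgr G | is_subgraph P && iso_to H P].

Definition mono (r : nat) (G : sgraph) (f : coloring r G) (P : subgr G) : bool :=
  [exists c : 'I_r, [forall e : edge G, (val e \in P.2) ==> (f e == c)]].

Definition mono_copies (r : nat) (H G : sgraph) (f : coloring r G) :
  {set subgr G} := [set P in copies H G | mono f P].

Definition arrows (r : nat) (G H : sgraph) : Prop :=
  forall f : coloring r G, exists P : subgr G, P \in mono_copies H f.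

(* The unit #|copies H G| of the iterated minimum bounds every term from
   above, so it does not affect the minimum whenever some coloring exists. *)
Definition multiplicity (r : nat) (H G : sgraph) : nat :=
  \big[minn/#|copies H G|]_(f : coloring r G) #|mono_copies H f|.

Definition robustness (R : realType) (r : nat) (H G : sgraph) : R :=
  ((multiplicity r H G)%:R / (multiplicity 1 H G)%:R)%R.

Section Blowup.
Variables (G : sgraph) (n : nat).

Definition blowup_rel : rel (G * 'I_n)%type := fun a b => sedge a.1 b.1.

Lemma blowup_sym : symmetric blowup_rel.
Proof. by move=> a b; apply: sedge_sym. Qed.

Lemma blowup_irr : irreflexive blowup_rel.
Proof. by move=> a; apply: sedge_irr. Qed.

Definition blowup : sgraph := SGraph blowup_sym blowup_irr.

Definition part (v : G) : {set blowup} := [set a : blowup | a.1 == v].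
End Blowup.

Arguments part {G n} v.

Definition canonical (H G : sgraph) (t n : nat) (P : subgr (blowup G n)) : Prop :=
  exists H' : subgr G, exists S : G -> {set blowup G n},
    [/\ H' \in copies H G,
        forall v : G, v \in H'.1 -> S v \subset part v /\ #|S v| = t,
        P.1 = \bigcup_(v in H'.1) S v &
        P.2 = [set e in edges (blowup G n) |
                [exists x : G, exists y : G, exists a in S x, exists b in S y,
                   ([set x; y] \in H'.2) && (e == [set a; b])]]].

Definition canonically_ramsey (r : nat) (H : sgraph) (t : nat)
    (G : sgraph) (n : nat) : Prop :=
  forall f : coloring r (blowup G n),
    exists P : subgr (blowup G n),
      P \in mono_copies (blowup H t) f /\ canonical H t P.

Definition ramsey_const (R : realType) (r : nat) (H G : sgraph) : R :=
  (expR (r%:R ^+ #|H| * 4 ^+ (#|H| ^ 2 - #|H|) / robustness R r H G ^+ #|H|))%R.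

(* Main.v *)
Require Import Defs.
From mathcomp Require Import all_boot all_order all_algebra.
From mathcomp Require Import all_classical all_reals all_analysis.
From mathcomp Require Import ring lra zify.

(** Choosing one vertex in each part of [G[N]] gives a copy of [G], a fraction
    [lambda_r(H,G)] of whose copies of [H] is monochromatic. Averaging over all
    choices [phi], over the copies of [H] in [G] and over the colours fixes one
    copy [P] and one colour for which a fraction
    [delta = lambda_r(H,G) / r] of the [phi] is good. As in Nikiforov's theorem
    on graphs with many cliques, such a dense set [W] of good [phi] contains
    [t] members with distinct values at each vertex of [P] such that any two of
    these values at different vertices are realised by a common member of [W],
    provided [t <= delta^h 4^(-h(h-1)) ln N]: drop a vertex [v], keep the [phi]
    with at least [delta N / 2] good extensions at [v], find by induction
    [m] = O(log N) of those, and apply the pigeonhole principle to the subset of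
    the [m] members that a value at [v] extends. *)

Set Implicit Arguments.
Unset Strict Implicit.
Unset Printing Implicit Defensive.

Import Order.TTheory GRing.Theory Num.Theory.

Local Open Scope ring_scope.

(** * Averaging and pigeonhole principles *)

(** A heavy term is at most [M], a light one at most [theta]. Read backwards, this bounds the number
    of heavy terms from below. *)
Lemma sum_le_heavy (R : realFieldType) (T : finType) (F : T -> nat) (M : nat)
    (theta : R) :
  0 <= theta -> (forall x, (F x <= M)%N) ->
  (\sum_x F x)%N%:R <=
  #|[set x | theta <= (F x)%:R]|%:R * M%:R + theta * #|T|%:R.
Proof.
move=> th0 FM; rewrite natr_sum.
have -> : #|[set x | theta <= (F x)%:R]|%:R * M%:R + theta * #|T|%:R =
  \sum_x ((if theta <= (F x)%:R then M%:R else 0) + theta).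
  rewrite big_split /= -big_mkcond /= !sumr_const mulr_natl mulr_natr.
  by congr (_ *+ _ + _); apply: eq_card => x; rewrite !inE.
apply: ler_sum => x _; case: ifP => [_|/negbT]; last first.
  by rewrite -ltNge add0r => /ltW.
by rewrite -[leLHS]addr0 lerD // ler_nat.
Qed.

Lemma exists_heavy_term (R : realFieldType) (T : finType) (P : pred T)
    (F : T -> nat) (theta : R) :
  (0 < #|P|)%N -> theta * #|P|%:R <= (\sum_(x | P x) F x)%N%:R ->
  exists2 x, P x & theta <= (F x)%:R.
Proof.
move=> P0 le_sum.
have [/existsP[x /andP[Px ?]]|] := boolP [exists x, P x && (theta <= (F x)%:R)].
  by exists x.
rewrite negb_exists => /forallP light.
have [x0 Px0] : exists x, P x by case/card_gt0P: P0 => x; exists x.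
move: le_sum; rewrite leNgt natr_sum => /negP[].
rewrite mulr_natr -sumr_const; apply: ltr_sum => [|x Px].
  by apply/hasP; exists x0; rewrite ?mem_index_enum.
by have := light x; rewrite Px /= -ltNge.
Qed.

Lemma exists_injective_into (T : finType) (A : {set T}) (t : nat) :
  (t <= #|A|)%N -> exists2 g : 'I_t -> T, injective g & forall k, g k \in A.
Proof.
move=> tA; exists (fun k => enum_val (widen_ord tA k)); last first.
  by move=> k; apply: enum_valP.
by move=> k l /enum_val_inj /(congr1 val) /= kl; apply: val_inj.
Qed.

Lemma pigeonhole_fiber (T U : finType) (B : {set T}) (g : T -> U) (t : nat) :
  (0 < #|U|)%N -> (t * #|U| <= #|B|)%N ->
  exists u : U, (t <= #|[set y in B | g y == u]|)%N.
Proof.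
move=> U0 tB.
have cardB : #|B| = (\sum_u #|[set y in B | g y == u]|)%N.
  rewrite -sum1_card (partition_big g predT) //=.
  apply: eq_bigr => u _; rewrite -sum1_card; apply: eq_bigl => y.
  by rewrite inE.
have [|u _] := @exists_heavy_term rat U predT
  (fun u => #|[set y in B | g y == u]|) t%:R U0; last first.
  by rewrite ler_nat; exists u.
by rewrite -natrM ler_nat -cardB.
Qed.

(** * Spanning families inside dense sets of functions *)

Section DenseFamilies.
Variables (V : finType) (N : nat).
Implicit Types (phi psi : {ffun V -> 'I_N}) (W : {set {ffun V -> 'I_N}}).
Implicit Types (A : {set V}) (v : V).

Definition upd phi v (y : 'I_N) : {ffun V -> 'I_N} :=
  [ffun x => if x == v then y else phi x].

Lemma upd_same phi v y : upd phi v y v = y.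
Proof. by rewrite ffunE eqxx. Qed.

Lemma upd_other phi v y x : x != v -> upd phi v y x = phi x.
Proof. by rewrite ffunE => /negbTE->. Qed.

(** The involution that exchanges [phi v] and [y] on pairs [(phi, y)] turns the condition
    [upd phi v y \in W] into membership of the first component in [W]. *)
Lemma sum_card_upd W v :
  (\sum_phi #|[set y | upd phi v y \in W]| = #|W| * N)%N.
Proof.
pose swap (p : {ffun V -> 'I_N} * 'I_N) := (upd p.1 v p.2, p.1 v).
have swapK : involutive swap.
  move=> [phi y]; rewrite /swap /= upd_same; congr pair.
  by apply/ffunP => x; rewrite !ffunE; case: eqP => // ->.
transitivity (\sum_(p : {ffun V -> 'I_N} * 'I_N | (swap p).1 \in W) 1)%N.
  rewrite -(pair_big_dep predT (fun phi y => upd phi v y \in W)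
    (fun _ _ => 1%N)) /=.
  apply: eq_bigr => phi _; rewrite -sum1_card; apply: eq_bigl => y.
  by rewrite inE.
rewrite -(reindex_inj (P := fun p : {ffun V -> 'I_N} * 'I_N => p.1 \in W)
  (F := fun=> 1%N) (inv_inj swapK)).
transitivity #|finset.setX W [set: 'I_N]|; last by rewrite cardsX cardsT card_ord.
by rewrite -sum1_card; apply: eq_bigl => p; rewrite !inE andbT.
Qed.

(* The coordinates of [w] on [A] span a complete [#|A|]-partite graph with
   parts of size [t], every edge of which lies in some member of [W]. Keeping
   the [w k] themselves in [W] is what makes the induction on [A] work. *)
Definition spans_family W A (t : nat) (w : 'I_t -> {ffun V -> 'I_N}) : Prop :=
  [/\ forall k, w k \in W,
      forall x, x \in A -> injective (fun k => w k x) &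
      forall x y k l, x \in A -> y \in A -> x != y ->
        exists2 phi, phi \in W & phi x = w k x /\ phi y = w l y].

(** The gluing step of the induction. A pair of values involving [v] is realised by some
    [upd (w (g k)) v (y l)]; a pair avoiding [v] is realised in [W'], and extending at [v] leaves
    both values unchanged. *)
Lemma spans_family_upd W A v (m t : nat) (w : 'I_m -> {ffun V -> 'I_N})
    (g : 'I_t -> 'I_m) (y : 'I_t -> 'I_N) W' :
  spans_family W' (A :\ v) w ->
  (forall phi, phi \in W' -> exists z, upd phi v z \in W) ->
  injective g -> injective y -> (forall k l, upd (w (g k)) v (y l) \in W) ->
  spans_family W A (fun k => upd (w (g k)) v (y k)).
Proof.
move=> [wW' winj wpair] ext ginj yinj wy; split=> // [x xA k l|x z k l xA zA xz].
  have [->|xv] := eqVneq x v; first by rewrite !upd_same => /yinj.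
  by rewrite !upd_other // => /winj kl; apply/ginj/kl; rewrite !inE xv.
have [xv|xv] := eqVneq x v.
  rewrite xv eq_sym in xz *; exists (upd (w (g l)) v (y k)) => //.
  by rewrite !upd_same !upd_other.
have [zv|zv] := eqVneq z v.
  rewrite zv in xz *; exists (upd (w (g k)) v (y l)) => //.
  by rewrite !upd_same !upd_other.
have [| |phi /ext[z' phiW] [phix phiz]] := wpair x z (g k) (g l) _ _ xz.
- by rewrite !inE xv.
- by rewrite !inE zv.
by exists (upd phi v z') => //; rewrite !upd_other.
Qed.


(** Numerical part of the induction, with [L] a lower bound for the logarithm of [N]. Here [m] is
    the family size available at density [delta / 2]; the last two bounds serve the averaging over
    values at [v] and the pigeonhole over the [2 ^ m] index sets. *)
Lemma family_size_bounds (R : realType) (h : nat) (delta L : R) (t : nat) :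
  0 < delta -> delta <= 1 -> (0 < t)%N ->
  t%:R <= delta ^+ h.+2 / 4 ^+ (h.+2 * h.+1) * L ->
  let m := Num.truncn ((delta / 2) ^+ h.+1 / 4 ^+ (h.+1 * h) * L) in
  [/\ m%:R <= (delta / 2) ^+ h.+1 / 4 ^+ (h.+1 * h) * L,
      (0 < m)%N,
      t%:R <= delta / 4 * m%:R &
      t%:R * 2 ^+ m <= delta / 4 * expR L].
Proof.
move=> d0 d1 t0 tL m; set q := _ * L in m *.
have t1 : 1 <= t%:R :> R by rewrite ler1n.
have L0 : 0 < L.
  rewrite -(@pmulr_rgt0 _ (delta ^+ h.+2 / 4 ^+ (h.+2 * h.+1))).
    by apply: lt_le_trans tL; rewrite ltr0n.
  by rewrite divr_gt0 ?exprn_gt0.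
have q0 : 0 < q by rewrite mulr_gt0 // divr_gt0 ?exprn_gt0 ?divr_gt0.
have tq : t%:R <= delta * q / 8.
  apply: le_trans tL _.
  (* Going from [h.+1] to [h.+2] costs [16 ^ h.+1] in the denominator; halving [delta] uses
     [2 ^ h.+1] of it and leaves [8 ^ h.+1], of which one factor 8 suffices. *)
  have -> : delta ^+ h.+2 / 4 ^+ (h.+2 * h.+1) * L = delta * q / 8 ^+ h.+1.
    have -> : (h.+2 * h.+1 = h.+1 * h + 2 * h.+1)%N by lia.
    have -> : 4 ^+ (h.+1 * h + 2 * h.+1) = 4 ^+ (h.+1 * h) * (2 ^+ h.+1 * 8 ^+ h.+1) :> R.
      by rewrite exprD [4 ^+ (2 * _)]exprM -exprMn; congr (_ * _ ^+ _); ring.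
    rewrite /q expr_div_n [delta ^+ h.+2]exprS; field.
    by rewrite !expf_neq0.
  apply: ler_wpM2l; first by rewrite ltW // mulr_gt0.
  rewrite lef_pV2 ?posrE ?exprn_gt0 //.
  by rewrite -[leLHS]expr1 ler_weXn2l // ler1n.
have qL : q <= L / 2.
  rewrite /q mulrC; apply: ler_wpM2l; first exact: ltW.
  apply: (@le_trans _ _ ((delta / 2) ^+ h.+1)).
    rewrite ler_pdivrMr ?exprn_gt0 // ler_peMr ?exprn_ge0 //; first lra.
    by rewrite exprn_ege1 // ler1n.
  apply: le_trans (_ : (1 / 2) ^+ h.+1 <= _).
    by rewrite lerXn2r ?nnegrE //; lra.
  rewrite exprS div1r ler_piMr ?exprn_ile1 //; lra.
have mq : m%:R <= q by rewrite truncn_le // ltW.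
have qm : q < m%:R + 1 by rewrite natr1; apply: truncnS_gt.
(* As [1 <= t], the bound [tq] forces [8 <= delta * q <= q], so rounding [q] down to [m] loses less
   than half. *)
have q8 : 8 <= q.
  have : delta * q <= q by rewrite ler_piMl // ltW.
  lra.
have m1 : 1 <= m%:R :> R by lra.
split=> //.
- by rewrite -(ltr0n R); lra.
- apply: le_trans tq _; rewrite mulrAC -mulrA -[leRHS]mulrA ler_pM2l //.
  lra.
(* Half of the exponent [L] absorbs [2 ^ m], since [m <= q <= L / 2]; the other half absorbs [t]. *)
- have e2 : 2 ^+ m <= expR (L / 2).
    apply: (@le_trans _ _ (expR m%:R)); last by rewrite ler_expR; lra.
    rewrite -[m%:R]mulr1 expRM_natl lerXn2r ?nnegrE ?expR_ge0 //.
    have := expR_ge1Dx (1 : R); lra.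
  have eL := expR_ge1Dx (L / 2).
  have -> : L = L / 2 + L / 2 by field.
  rewrite expRD mulrA; apply: ler_pM => //.
  apply: le_trans tq _.
  rewrite -mulrA -[leRHS]mulrA ler_pM2l //; lra.
Qed.

(** Induction on the size of [A]. Density is measured over all of [V], so coordinates outside [A]
    need no separate treatment. *)
Lemma exists_spanning_family (R : realType) (h : nat) W A (delta L : R) t :
  #|A| = h.+1 -> 0 < delta -> delta * N%:R ^+ #|V| <= #|W|%:R ->
  expR L <= N%:R -> t%:R <= delta ^+ h.+1 / 4 ^+ (h.+1 * h) * L ->
  exists w : 'I_t -> {ffun V -> 'I_N}, spans_family W A w.
Proof.
move=> cA d0 dW eLN tL.
have N0r : 0 < N%:R :> R by apply: lt_le_trans eLN; apply: expR_gt0.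
have N0 : (0 < N)%N by rewrite ltr0n in N0r.
have cV : #|{ffun V -> 'I_N}|%:R = N%:R ^+ #|V| :> R.
  by rewrite card_ffun card_ord natrX.
have [t0|t0] := posnP t.
  by subst t; exists (fun=> [ffun=> Ordinal N0]); split=> [[]|x _ []|x y []].
elim: h => [|h IH] in W A delta t cA d0 dW tL t0 *.
  (* For a single vertex, some [phi] has at least [delta * N] good values at [v], and
     [t <= delta * L <= delta * expR L]. *)
  move/eqP/cards1P: cA => [v ->].
  have [||phi _ dphi] := @exists_heavy_term R _ predT
    (fun phi => #|[set y | upd phi v y \in W]|) (delta * N%:R).
  - by rewrite -(ltr0n R) cV exprn_gt0.
  - by rewrite sum_card_upd cV natrM mulrAC ler_wpM2r // ler0n.
  have td : (t <= #|[set y | upd phi v y \in W]|)%N.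
    rewrite -(ler_nat R); apply: le_trans dphi.
    apply: le_trans tL _; rewrite expr1 muln0 expr0 divr1 ler_pM2l //.
    apply: le_trans eLN; have := expR_ge1Dx L; lra.
  have [y yinj yW] := exists_injective_into td.
  exists (fun k => upd phi v (y k)).
  apply: (@spans_family_upd _ _ _ t t (fun=> phi) id y [set phi]) => //.
  - by split=> [k|x|x ? ? ?]; rewrite ?finset.setDv inE.
  - move=> _ /set1P->; exists (y (Ordinal t0)).
    by have := yW (Ordinal t0); rewrite inE.
  - by move=> k l; have := yW l; rewrite inE.
have d1 : delta <= 1.
  rewrite -(ler_pM2r (exprn_gt0 #|V| N0r)) mul1r.
  by apply: le_trans dW _; rewrite -cV ler_nat max_card.
have [v vA] : exists v, v \in A by apply/set0Pn; rewrite -card_gt0 cA.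
have := family_size_bounds d0 d1 t0 tL; set m := Num.truncn _.
move=> [mL m0 tm tmL].
pose ext phi := [set y | upd phi v y \in W].
pose W' := [set phi | delta / 2 * N%:R <= #|ext phi|%:R].
(* The numbers of good extensions sum to at least [delta * N ^ (#|V| + 1)], and the light [phi]
   account for at most half of this. *)
have dW' : delta / 2 * N%:R ^+ #|V| <= #|W'|%:R.
  have := @sum_le_heavy R _ (fun phi => #|ext phi|) N (delta / 2 * N%:R).
  rewrite sum_card_upd cV natrM -/W' => /(_ _ _)/le_trans H.
  have {H} : #|W|%:R * N%:R <= #|W'|%:R * N%:R + delta / 2 * N%:R * N%:R ^+ #|V|.
    apply: H => //; first by rewrite ltW // !mulr_gt0 // invr_gt0.
    by move=> phi; rewrite -[leqRHS]card_ord max_card.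
  rewrite [delta / 2 * _ * _]mulrAC -mulrDl ler_pM2r //; lra.
have cA' : #|A :\ v| = h.+1 by move: (cardsD1 v A); rewrite vA cA => -[].
have [|w wspan] := IH W' (A :\ v) (delta / 2) m cA' _ dW' mL m0.
  by rewrite divr_gt0.
have [wW' _ _] := wspan.
(* [Ks y] records which of the [m] members the value [y] extends; [B] keeps the values extending at
   least [t] of them. *)
pose Ks y := [set k | y \in ext (w k)].
pose B := [set y | t%:R <= #|Ks y|%:R :> R].
have dB : delta / 4 * N%:R <= #|B|%:R.
  have m0r : 0 < m%:R :> R by rewrite ltr0n.
  have lower : m%:R * (delta / 2 * N%:R) <= (\sum_y #|Ks y|)%N%:R.
    have -> : (\sum_y #|Ks y| = \sum_k #|ext (w k)|)%N.
      under eq_bigr do rewrite -sum1_card big_mkcond.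
      rewrite exchange_big /=; apply: eq_bigr => k _.
      by rewrite -sum1_card [RHS]big_mkcond; apply: eq_bigr => y _; rewrite !inE.
    have -> : m%:R * (delta / 2 * N%:R) = \sum_(k < m) (delta / 2 * N%:R).
      by rewrite sumr_const card_ord mulr_natl.
    rewrite natr_sum.
    by apply: ler_sum => k _; have := wW' k; rewrite inE.
  have upper := @sum_le_heavy R _ (fun y => #|Ks y|) m t%:R.
  have {upper} : (\sum_y #|Ks y|)%N%:R <= #|B|%:R * m%:R + t%:R * N%:R :> R.
    rewrite -[X in _ + _ * X%:R]card_ord; apply: upper => // y.
    by rewrite -[leqRHS]card_ord max_card.
  have tN : t%:R * N%:R <= delta / 4 * m%:R * N%:R by rewrite ler_pM2r.
  move=> upper; rewrite -(ler_pM2r m0r); lra.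
(* At least [t] values in [B] share one index set [K], and [K] has at least [t] elements by
   definition of [B]. Hence each of these values extends every member indexed by [K]. *)
have [||K tK] := @pigeonhole_fiber _ _ B Ks t.
- by apply/card_gt0P; exists finset.set0.
- rewrite -cardsT -powersetT card_powerset cardsT card_ord -(ler_nat R) natrM natrX.
  apply: le_trans dB; apply: le_trans tmL _.
  by rewrite ler_pM2l // divr_gt0.
have tcK : (t <= #|K|)%N.
  have /card_gt0P[y] := leq_trans t0 tK.
  by rewrite !inE ler_nat => /andP[ty /eqP<-].
have [g ginj gK] := exists_injective_into tcK.
have [y yinj yK] := exists_injective_into tK.
exists (fun k => upd (w (g k)) v (y k)).
apply: spans_family_upd wspan _ ginj yinj _ => [phi|k l].
  rewrite inE => dphi; have /card_gt0P[z] : (0 < #|ext phi|)%N.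
    by rewrite -(ltr0n R); apply: lt_le_trans dphi; rewrite !mulr_gt0 // invr_gt0.
  by rewrite inE; exists z.
have := yK l; rewrite !inE => /andP[_ /eqP yl].
by have := gK k; rewrite -yl !inE.
Qed.

End DenseFamilies.

(** * Edges and multiplicities *)

Lemma edgesP (G : sgraph) (e : {set G}) :
  reflect (exists x y, sedge x y /\ e = [set x; y]) (e \in edges G).
Proof.
apply: (iffP imsetP) => [[[x y] xy ->]|[x [y [xy ->]]]].
  by exists x, y; rewrite inE in xy.
by exists (x, y); rewrite ?inE.
Qed.

Lemma edges_set2 (G : sgraph) (x y : G) : ([set x; y] \in edges G) = sedge x y.
Proof.
apply/edgesP/idP => [[u [v [uv xyuv]]]|xy]; last by exists x, y.
have uNv : u != v by apply: contraTneq uv => ->; rewrite sedge_irr.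
have /setP memE := xyuv.
have := memE u; have := memE v; rewrite !inE !eqxx !orbT /=.
case/orP=> /eqP vE; case/orP=> /eqP uE; rewrite vE uE ?eqxx // in uv uNv *.
by rewrite sedge_sym.
Qed.

Lemma multiplicity_le (r : nat) (H G : sgraph) (f : coloring r G) :
  (multiplicity r H G <= #|mono_copies H f|)%N.
Proof.
rewrite /multiplicity; have : f \in index_enum (coloring r G) by exact: mem_index_enum.
elim: (index_enum _) => // g s IH; rewrite inE big_cons geq_min.
by case/orP=> [/eqP<-|/IH->]; rewrite ?leqnn ?orbT.
Qed.

Lemma multiplicity1 (H G : sgraph) : multiplicity 1 H G = #|copies H G|.
Proof.
rewrite /multiplicity; apply: (big_ind (fun m => m = #|copies H G|)).
- by [].
- by move=> _ _ -> ->; exact: minnn.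
move=> f _.
apply: eq_card => P; rewrite inE andb_idr // => _.
by apply/existsP; exists ord0; apply/forallP => e; rewrite ord1 eqxx implybT.
Qed.

Lemma multiplicity_gt0 (r : nat) (H G : sgraph) :
  (0 < r)%N -> arrows r G H -> (0 < multiplicity r H G)%N.
Proof.
move=> r0 GH; rewrite /multiplicity; apply: (big_ind (fun m => 0 < m)%N).
(* The unit of the minimum must be positive too: a constant colouring already yields a copy of
   [H]. *)
- have [P] := GH [ffun=> Ordinal r0]; rewrite inE => /andP[PH _].
  by apply/card_gt0P; exists P.
- by move=> a b a0 b0; rewrite leq_min a0.
- by move=> f _; have [P PH] := GH f; apply/card_gt0P; exists P.
Qed.

(** * Sections of the blowup and the colourings they induce *)

Section Sections.
Variables (r : nat) (G : sgraph) (N : nat) (f : coloring r (blowup G N)).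
Implicit Types (phi : {ffun G -> 'I_N}) (P : subgr G) (c : 'I_r).

Definition section_edge phi (e : {set G}) : {set blowup G N} :=
  [set (x, phi x) | x in e].

Lemma section_edge_set2 phi x y :
  section_edge phi [set x; y] = [set (x, phi x); (y, phi y)].
Proof. by rewrite /section_edge imsetU1 imset_set1. Qed.

Lemma section_edgeP phi (e : edge G) :
  section_edge phi (val e) \in edges (blowup G N).
Proof.
case: e => e /= /edgesP[x [y [xy ->]]].
by rewrite section_edge_set2 (@edges_set2 (blowup G N)).
Qed.

(** The pullback of [f] along the embedding of [G] that sends [x] to [(x, phi x)]. *)
Definition section_coloring phi : coloring r G :=
  [ffun e => f (exist (fun s => s \in edges (blowup G N)) _ (section_edgeP phi e))].

Definition mono_in c (g : coloring r G) P : bool :=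
  [forall e : edge G, (val e \in P.2) ==> (g e == c)].

Definition mono_sections P c : {set {ffun G -> 'I_N}} :=
  [set phi | mono_in c (section_coloring phi) P].

(** Double counting of triples [(phi, P, c)]: each [phi] lies in at least [multiplicity r H G] of
    them, and there are [#|copies H G| * r] pairs [(P, c)]. *)
Lemma exists_dense_sections (R : realType) (H : sgraph) :
  (0 < r)%N -> arrows r G H ->
  exists P, exists2 c, P \in copies H G &
    robustness R r H G / r%:R * N%:R ^+ #|G| <= #|mono_sections P c|%:R.
Proof.
move=> r0 GH.
have copies0 : (0 < #|copies H G|)%N.
  apply: leq_trans (multiplicity_gt0 r0 GH) _.
  apply: leq_trans (multiplicity_le _ [ffun=> Ordinal r0]) _.
  by apply/subset_leq_card/fintype.subsetP => P; rewrite inE => /andP[].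
pose Q := [pred q : subgr G * 'I_r | q.1 \in copies H G].
have cardQ : #|Q| = (#|copies H G| * r)%N.
  rewrite -[r in RHS]card_ord -cardsT -cardsX.
  by apply: eq_card => q; rewrite !inE andbT.
have [||[P c] PH dP] := @exists_heavy_term R _ Q
  (fun q => #|mono_sections q.1 q.2|) (robustness R r H G / r%:R * N%:R ^+ #|G|).
- by rewrite cardQ muln_gt0 copies0.
- have -> : robustness R r H G / r%:R * N%:R ^+ #|G| * #|Q|%:R =
    (N ^ #|G| * multiplicity r H G)%N%:R.
    rewrite cardQ /robustness multiplicity1 !natrM natrX; field.
    by rewrite !pnatr_eq0 -!lt0n r0 copies0.
  rewrite ler_nat.
  under eq_bigr do rewrite -sum1_card big_mkcond.
  rewrite exchange_big /= -[N in (N ^ _)%N]card_ord -card_ffun -sum_nat_const.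
  apply: leq_sum => phi _; rewrite -big_mkcondr sum1_card.
  apply: leq_trans (multiplicity_le _ (section_coloring phi)) _.
  set B := (X in (_ <= #|X|)%N).
  (* Forgetting the colour maps the good pairs onto the monochromatic copies. It need not be
     injective, as an edgeless copy is monochromatic in every colour. *)
  apply: (leq_trans _ (leq_imset_card (fun q : subgr G * 'I_r => q.1) B)).
  apply/subset_leq_card/fintype.subsetP => P; rewrite inE => /andP[PH /existsP[c Pc]].
  by apply/imsetP; exists (P, c) => //; rewrite /B -topredE /= PH inE.
by exists P, c.
Qed.

(** The values of the family at each vertex of [P] form the parts; every edge between them lies in a
    section from the family's dense set, where it has colour [c]. *)
Lemma canonical_mono_copy (H : sgraph) t P c (w : 'I_t -> {ffun G -> 'I_N}) :
  P \in copies H G -> spans_family (mono_sections P c) P.1 w ->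
  exists Q, Q \in mono_copies (blowup H t) f /\ Defs.canonical H t Q.
Proof.
move=> PH [wW winj wpair].
have := PH; rewrite inE => /andP[/andP[/fintype.subsetP P2G /forallP P2P1]].
case/existsP=> g /and3P[/injectiveP ginj /eqP gP1 /eqP gP2].
have P2_set2 x y : [set x; y] \in P.2 -> [/\ x \in P.1, y \in P.1 & sedge x y].
  move=> xyP; have := P2P1 [set x; y]; rewrite xyP /= => /fintype.subsetP sub.
  by rewrite !sub ?inE ?eqxx ?orbT // -edges_set2 P2G.
pose S v : {set blowup G N} := [set (v, w k v) | k : 'I_t].
pose Q : subgr (blowup G N) := (\bigcup_(v in P.1) S v,
  [set e in edges (blowup G N) |
    [exists x : G, exists y : G, exists a in S x, exists b in S y,
      ([set x; y] \in P.2) && (e == [set a; b])]]).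
have Q2P e : reflect (exists x y k l, [set x; y] \in P.2 /\
    e = [set (x, w k x); (y, w l y)]) (e \in Q.2).
  apply: (iffP idP).
    rewrite inE => /andP[_] /existsP[x /existsP[y]] /existsP[a].
    case/andP=> /imsetP[k _ ->] /existsP[b] /andP[/imsetP[l _ ->]].
    by case/andP=> xyP /eqP->; exists x, y, k, l.
  case=> x [y [k [l [xyP ->]]]]; have [_ _ xy] := P2_set2 _ _ xyP.
  rewrite inE (@edges_set2 (blowup G N)) {1}/sedge /= /blowup_rel /= xy /=.
  apply/existsP; exists x; apply/existsP; exists y.
  apply/existsP; exists (x, w k x); rewrite imset_f //=.
  apply/existsP; exists (y, w l y); rewrite imset_f //=.
  by rewrite xyP eqxx.
exists Q; split; last first.
  exists P, S; split=> // v vP; split.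
    by apply/fintype.subsetP => a /imsetP[k _ ->]; rewrite inE.
  by rewrite card_imset ?card_ord // => k l [/winj kl]; apply: kl.
rewrite !inE -!andbA; apply/and4P; split.
- by apply/fintype.subsetP => e; rewrite inE => /andP[].
- apply/forallP => e; apply/implyP => /Q2P[x [y [k [l [xyP ->]]]]].
  have [xP yP _] := P2_set2 _ _ xyP.
  apply/fintype.subsetP => a /set2P[] ->; apply/bigcupP.
    by exists x => //; apply: imset_f.
  by exists y => //; apply: imset_f.
- have gP u : g u \in P.1 by rewrite -gP1 imset_f.
  have gE u v : ([set g u; g v] \in P.2) = sedge u v.
    have -> : [set g u; g v] = g @: [set u; v] by rewrite imsetU1 imset_set1.
    by rewrite -edges_set2 -gP2 (mem_imset _ _ (imset_inj ginj)).
  pose F : {ffun blowup H t -> blowup G N} :=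
    [ffun a => (g a.1, w a.2 (g a.1))].
  apply/existsP; exists F; apply/and3P; split.
  + apply/injectiveP => -[u k] [v l]; rewrite !ffunE /= => -[/ginj <-].
    by move/(winj _ (gP u))->.
  + apply/eqP/setP => a; apply/imsetP/bigcupP.
      case=> -[u k] _ ->; rewrite ffunE /=.
      by exists (g u) => //; apply: imset_f.
    case=> v; rewrite -gP1 => /imsetP[u _ ->] /imsetP[k _ ->].
    by exists (u, k); rewrite ?inE // ffunE.
  + apply/eqP/setP => e; apply/imsetP/Q2P.
      case=> _ /edgesP[[u k] [[v l] [uv ->]]] ->.
      exists (g u), (g v), k, l.
      by rewrite gE imsetU1 imset_set1 !ffunE.
    case=> x [y [k [l [xyP ->]]]]; have [] := P2_set2 _ _ xyP.
    rewrite -gP1 => /imsetP[u _ xu] /imsetP[v _ yv] _.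
    rewrite xu yv gE in xyP *; exists [set (u, k); (v, l)].
      by rewrite (@edges_set2 (blowup H t)).
    by rewrite imsetU1 imset_set1 !ffunE.
- apply/existsP; exists c; apply/forallP => e; apply/implyP.
  case/Q2P => x [y [k [l [xyP eE]]]]; have [xP yP xy] := P2_set2 _ _ xyP.
  have xNy : x != y by apply: contraTneq xy => ->; rewrite sedge_irr.
  (* A common [phi] identifies the blowup edge with the image of the edge [xy] of [P] in a section
     whose copy of [P] has colour [c]. *)
  have [phi] := wpair x y k l xP yP xNy; rewrite inE => /forallP phiW [phix phiy].
  have := phiW (exist (fun s => s \in edges G) _ (P2G _ xyP)); rewrite /= xyP /= ffunE => /eqP <-.
  apply/eqP; congr (f _); apply: val_inj.
  by rewrite /= section_edge_set2 phix phiy.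
Qed.

End Sections.

(** * Choice of density and logarithm *)

Theorem theorem2p1 (R : realType) (r : nat) (G H : sgraph)
    (hr : (1 <= r)%N) (hGH : arrows r G H) (t : nat) (ht : (0 < t)%N) :
  canonically_ramsey r H t G (absz (Num.ceil (ramsey_const R r H G ^+ t)%R)).
Proof.
set N := absz _ => f.
have [P [c PH dense]] := exists_dense_sections f R hr hGH.
suff [w wspan] : exists w : 'I_t -> {ffun G -> 'I_N},
    spans_family (mono_sections f P c) P.1 w.
  exact: canonical_mono_copy PH wspan.
have rho0 : 0 < robustness R r H G.
  have M0 := multiplicity_gt0 hr hGH.
  rewrite divr_gt0 // ltr0n // multiplicity1.
  by apply/card_gt0P; exists P.
have r0 : 0 < r%:R :> R by rewrite ltr0n.
have cN : ramsey_const R r H G ^+ t <= N%:R.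
  by rewrite natr_absz; apply: le_trans (ceil_ge _) _; rewrite ler_int ler_norm.
have N0 : 0 < N%:R :> R.
  by apply: lt_le_trans cN; rewrite exprn_gt0 // expR_gt0.
have cP : #|P.1| = #|H|.
  move: PH; rewrite inE => /andP[_ /existsP[g /and3P[/injectiveP ginj /eqP<- _]]].
  by rewrite card_imset // cardsT.
have delta0 : 0 < robustness R r H G / r%:R by rewrite divr_gt0.
(* The spanning lemma requires a nonempty vertex set; for empty [H] any constant family works. *)
case hE : #|H| => [|h].
  have /card_gt0P[phi phiW] : (0 < #|mono_sections f P c|)%N.
    by rewrite -(ltr0n R); apply: lt_le_trans dense; rewrite mulr_gt0 ?exprn_gt0.
  move: cP; rewrite hE => /eqP; rewrite cards_eq0 => /eqP->.
  by exists (fun=> phi); split=> // [x|x y k l]; rewrite inE.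
(* Writing the power as a single exponential makes [L] equal to [t] times the exponent in
   [ramsey_const]; the required bound on [t] then holds with equality. *)
move: cN; rewrite /ramsey_const -expRM_natl => cN.
apply: (exists_spanning_family _ delta0 dense cN); first by rewrite cP hE.
have -> : (#|H| ^ 2 - #|H| = h.+1 * h)%N by rewrite hE; lia.
rewrite hE le_eqVlt; apply/orP; left; apply/eqP.
rewrite expr_div_n; field.
by rewrite !expf_neq0 ?gt_eqF.
Qed.
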